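(* Let $n\ge 2$. If $\mathcal{A}$ is a real $m$th order $n$-dimensional doubly circulant tensor with root tensor $\mathcal{A}_1$, then for any $\mathbf{x}\in\mathbb{R}^n$, $$\mathcal{A}\mathbf{x}^m=\Big(\sum_{k=1}^n x_k\Big)\,\mathcal{A}_1\mathbf{x}^{m-1}.$$ On the other hand, if $m$ is even and $\mathcal{A}$ is a real $m$th order $n$-dimensional circulant tensor whose root tensor $\mathcal{A}_1$ is doubly circulant, and $\mathcal{A}_{11}$ denotes the root tensor of $\mathcal{A}_1$, then: (a) $\mathcal{A}$ is doubly circulant. (b) If $\mathcal{A}_{11}$ is positive semi-definite, then $\mathcal{A}$ is positive semi-definite. (c) If $\mathcal{A}$ is positive semi-definite, then for any $\mathbf{x}\in\mathbb{R}^n$ satisfying $\sum_{k=1}^n x_k\ne0$, we have $\mathcal{A}_{11}\mathbf{x}^{m-2}\ge0$.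
   Context: Write $[n]=\{1,\dots,n\}$. A real $r$th order $n$-dimensional tensor is an array $\mathcal{T}=(t_{j_1\cdots j_r})$ of real numbers indexed by $[n]^r$; for $\mathbf{x}\in\mathbb{R}^n$, $\mathcal{T}\mathbf{x}^r=\sum_{j_1,\dots,j_r=1}^n t_{j_1\cdots j_r}x_{j_1}\cdots x_{j_r}\in\mathbb{R}$. For $r\ge2$, $\mathcal{T}$ is circulant if $t_{j_1\cdots j_r}=t_{k_1\cdots k_r}$ whenever $j_l,k_l\in[n]$ and $k_l\equiv j_l+1 \pmod n$ for all $l\in[r]$. The root tensor of a circulant tensor $\mathcal{T}$ of order $r$ is the order $r-1$ tensor with entries $t_{1j_1\cdots j_{r-1}}$. A circulant tensor is called doubly circulant if its root tensor is itself a circulant tensor. Since circulant tensors have order at least $2$, a doubly circulant tensor has order at least $3$ (so $m\ge3$ in the first assertion, and $m\ge4$ when $\mathcal{A}_1$ is doubly circulant and $m$ is even). For even $r$, $\mathcal{T}$ of order $r$ is positive semi-definite if $\mathcal{T}\mathbf{x}^r\ge0$ for all $\mathbf{x}\in\mathbb{R}^n$. *)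

(* Defs.v *)
From HB Require Import structures.
From mathcomp Require Import all_boot all_order all_algebra.
From mathcomp Require Import reals.
Set Implicit Arguments.
Unset Strict Implicit.
Unset Printing Implicit Defensive.
Import Order.TTheory GRing.Theory Num.Theory.
Local Open Scope ring_scope.

(* The index set {1, ..., n} is 'I_n = {0, ..., n - 1}: index k of the
   mathematics is the ordinal k - 1, so index 1 is ord0. *)
Definition tensor (R : Type) (n r : nat) : Type := r.-tuple 'I_n -> R.

Definition tensor_form (R : realType) (n r : nat) (T : tensor R n r)
    (x : 'rV[R]_n) : R :=
  \sum_(j : r.-tuple 'I_n) T j * \prod_(l < r) x 0 (tnth j l).

(* The order bound belongs to the definition: a circulant tensor has order
   at least 2, hence a doubly circulant one has order at least 3. *)
Definition circulant (R : realType) (n r : nat) (T : tensor R n r) : Prop :=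
  (2 <= r)%N /\
  forall j k : r.-tuple 'I_n,
    (forall l : 'I_r, tnth k l = tnth j l + 1 %[mod n])%N -> T j = T k.

Definition root_tensor (R : realType) (n r : nat) (T : tensor R n.+1 r.+1) :
    tensor R n.+1 r :=
  fun j => T [tuple of ord0 :: j].

Definition doubly_circulant (R : realType) (n r : nat)
    (T : tensor R n.+1 r.+1) : Prop :=
  circulant T /\ circulant (root_tensor T).

(* Used only for even r. *)
Definition positive_semidefinite (R : realType) (n r : nat)
    (T : tensor R n r) : Prop :=
  forall x : 'rV[R]_n, 0 <= tensor_form T x.

(* Main.v *)
(* Entries of a doubly circulant tensor do not depend on their first index:
   circulance of A lowers all indices by one, and circulance of the root tensor
   then undoes the change on the other indices.  Summing over the first index
   therefore factors out the sum of the coordinates; using this twice gives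
   A x^m = (sum_k x_k)^2 A_11 x^(m-2). *)

Require Import Defs.
From mathcomp Require Import all_boot all_order all_algebra.
From mathcomp Require Import reals.
Import Order.TTheory GRing.Theory Num.Theory.
Local Open Scope ring_scope.

Lemma sum_tuple_cons (V : nmodType) (T : finType) (r : nat)
    (F : r.+1.-tuple T -> V) :
  \sum_(j : r.+1.-tuple T) F j
  = \sum_(i : T) \sum_(j : r.-tuple T) F [tuple of i :: j].
Proof.
rewrite pair_big (reindex (fun p : T * r.-tuple T => [tuple of p.1 :: p.2])) //=.
exists (fun j : r.+1.-tuple T => (thead j, [tuple of behead j])) => [[i j] _|j _] /=.
  by congr pair; apply/val_inj.
by rewrite -tuple_eta.
Qed.

(** Ring addition in ['I_n.+2] is modulo [n.+2], so adding 1 to every index is the cyclic shift of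
    [circulant]. *)
Lemma circulant_translate {R : realType} {n r : nat} {T : tensor R n.+2 r}
    (j : r.-tuple 'I_n.+2) :
  circulant T -> T j = T [tuple of map (+%R^~ 1) j].
Proof.
case=> _; apply=> l.
by rewrite tnth_map /= modn_mod.
Qed.

Lemma doubly_circulant_cons (R : realType) (n r : nat)
    (A : tensor R n.+2 r.+1) (i : 'I_n.+2) (j : r.-tuple 'I_n.+2) :
  doubly_circulant A -> A [tuple of i :: j] = root_tensor A j.
Proof.
(* Writing [i] as a multiple of 1 allows induction on its value; [j] stays general since the
   induction hypothesis is used at the lowered tail [j']. *)
case=> cA cA1; rewrite -[i in LHS]natr_Zp.
elim: (i : nat) j => [|k IHk] j; first by congr A; apply/val_inj.
pose j' := [tuple of map (fun a => a - 1) j].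
have jE : j = [tuple of map (+%R^~ 1) j'].
  by apply: eq_from_tnth => l; rewrite !tnth_map subrK.
rewrite jE -(circulant_translate _ cA1) -IHk [RHS](circulant_translate _ cA).
by congr A; apply/val_inj; rewrite /= -natr1.
Qed.

Lemma tensor_form_doubly_circulant (R : realType) (n r : nat)
    (A : tensor R n.+2 r.+1) (x : 'rV[R]_n.+2) :
  doubly_circulant A ->
  tensor_form A x
  = (\sum_(k < n.+2) x 0 k) * tensor_form (root_tensor A) x.
Proof.
move=> dcA; rewrite /tensor_form sum_tuple_cons mulr_suml.
apply: eq_bigr => i _; rewrite mulr_sumr; apply: eq_bigr => j _.
rewrite doubly_circulant_cons // big_ord_recl tnth0 mulrCA.
by congr (_ * (_ * _)); apply: eq_bigr => l _; rewrite tnthS.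
Qed.

(* The dimension is n.+2 >= 2.  The order is m.+1 in the first part and m.+2
   in the second, so that the root tensors have orders m, resp. m.+1 and m. *)
Theorem proposition7 (R : realType) (n : nat) :
  (forall (m : nat) (A : tensor R n.+2 m.+1),
     doubly_circulant A ->
     forall x : 'rV[R]_n.+2,
       tensor_form A x
       = (\sum_(k < n.+2) x 0 k) * tensor_form (root_tensor A) x)
  /\
  (forall (m : nat) (A : tensor R n.+2 m.+2),
     ~~ odd m.+2 ->
     circulant A ->
     doubly_circulant (root_tensor A) ->
     [/\ doubly_circulant A,
         positive_semidefinite (root_tensor (root_tensor A)) ->
           positive_semidefinite A
       & positive_semidefinite A ->
           forall x : 'rV[R]_n.+2,
             \sum_(k < n.+2) x 0 k != 0 ->
             0 <= tensor_form (root_tensor (root_tensor A)) x]).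
Proof.
split=> [m A dcA x|m A _ cA dcA1]; first exact: tensor_form_doubly_circulant.
have dcA : doubly_circulant A by split=> //; case: dcA1.
have formE x : tensor_form A x =
    (\sum_(k < n.+2) x 0 k) ^+ 2 * tensor_form (root_tensor (root_tensor A)) x.
  by rewrite !tensor_form_doubly_circulant // mulrA expr2.
split=> // [psdA11 x|psdA x sx_neq0].
  by rewrite formE mulr_ge0 ?sqr_ge0.
(* The square of a nonzero sum is positive and cancels; were the sum zero, [formE] would only give
   [0 <= 0]. *)
by have := psdA x; rewrite formE pmulr_rge0 // exprn_even_gt0.
Qed.
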